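(* For every integer $d\ge 2$, there are infinitely many (pairwise non-isomorphic) $d$-regular Hamiltonian-transitive graphs.
   Context: All graphs are finite, simple and undirected. A Hamiltonian cycle is a cycle (of length at least 3) through all vertices, identified with its edge set. A graph is Hamiltonian-transitive if it has a Hamiltonian cycle and for every pair of Hamiltonian cycles there is an automorphism of the graph mapping one to the other. *)

(* Defs.v *)
(* Plain MathComp: a graph is a symmetric irreflexive boolean relation on a
   finite type, and an edge is the two-element set of its endpoints. *)
From mathcomp Require Import all_boot all_fingroup.

Set Implicit Arguments.
Unset Strict Implicit.
Unset Printing Implicit Defensive.

Record sgraph := SGraph {
  vertex :> finType;
  adj : rel vertex;
  adj_sym : symmetric adj;
  adj_irrefl : irreflexive adj }.

Definition isomorphic (G H : sgraph) : Prop :=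
  exists2 f : G -> H, bijective f & forall x y : G, adj (f x) (f y) = adj x y.

Definition regular (d : nat) (G : sgraph) : Prop :=
  forall x : G, #|[set y | adj x y]| = d.

Definition automorphism (G : sgraph) (s : {perm G}) : Prop :=
  forall x y : G, adj (s x) (s y) = adj x y.

(* [c] lists the vertices of a cycle in cyclic order; [next c x] wraps around
   at the end of [c]. *)
Definition cycle_edges (G : sgraph) (c : seq G) : {set {set G}} :=
  [set [set x; next c x] | x in c].

(* The bound on [size c] is needed: [ucycle] also holds of [::] and of
   [:: x; y] for adjacent [x] and [y]. *)
Definition hamiltonian_cycle (G : sgraph) (H : {set {set G}}) : Prop :=
  exists c : seq G,
    [/\ ucycle (@adj G) c, 3 <= size c, forall x : G, x \in c
      & H = cycle_edges c].

Definition map_edges (G : sgraph) (s : {perm G}) (H : {set {set G}}) :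
  {set {set G}} := [set s @: e | e : {set G} in H].

Definition hamiltonian_transitive (G : sgraph) : Prop :=
  (exists H : {set {set G}}, hamiltonian_cycle H) /\
  (forall H1 H2 : {set {set G}},
     hamiltonian_cycle H1 -> hamiltonian_cycle H2 ->
     exists2 s : {perm G}, automorphism s & map_edges s H1 = H2).

(* Main.v *)
(** A ring of at least two beads, each a complete graph on [d + 1] vertices
    minus an edge [uv], where the vertex [v] of each bead is joined to the
    vertex [u] of the next one.  A Hamiltonian cycle has to leave every bead, so
    up to reversal it runs through all the joining edges in the same direction,
    and inside each bead it is a Hamiltonian path from [u] to [v].  Since the
    [d - 1] other vertices of a bead can be permuted freely, all these cycles
    are equivalent under automorphisms. *)
Require Import Defs.
From mathcomp Require Import all_boot all_fingroup.

Set Implicit Arguments.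
Unset Strict Implicit.
Unset Printing Implicit Defensive.

(** * Hamiltonian cycles as successor functions *)

Section SuccessorFunctions.

Variable G : sgraph.
Implicit Types (f : G -> G) (s : {perm G}).

(** On more than two vertices, this is a Hamiltonian cycle with a chosen direction. Lengths along
    the cycle become iteration counts, and [finv] reverses the direction. *)
Definition hamiltonian_successor f :=
  [/\ injective f, forall x, adj x (f x) & forall x y, fconnect f x y].

Definition successor_edges f : {set {set G}} := [set [set x; f x] | x : G].

Lemma order_successor f x : hamiltonian_successor f -> fingraph.order f x = #|G|.
Proof. by case=> _ _ fC; apply: eq_card => y; rewrite inE; apply: fC. Qed.

(** The orbit of [x] is the whole graph, so the iterates before time [#|G|] are distinct: a return
    at a smaller [t] would have index [t], but the index of [x] itself is 0. *)
Lemma return_time_ge f x t :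
  hamiltonian_successor f -> 0 < t -> iter t f x = x -> #|G| <= t.
Proof.
move=> fH t0 tx; rewrite leqNgt; apply/negP => tG.
have := @findex_iter _ f x t; rewrite order_successor // tx findex0 => /(_ tG) t_eq0.
by rewrite -t_eq0 in t0.
Qed.

Lemma successor_no_2cycle f x :
  2 < #|G| -> hamiltonian_successor f -> f (f x) != x.
Proof.
by move=> G3 fH; apply/eqP => /(@return_time_ge _ _ 2 fH isT); rewrite leqNgt G3.
Qed.

Lemma hamiltonian_cycle_successor (H : {set {set G}}) :
  hamiltonian_cycle H ->
  exists2 f, hamiltonian_successor f & H = successor_edges f.
Proof.
case=> c [/andP[cc cu] _ cG ->]; exists (next c).
  split=> [|x|x y]; first by apply: can_inj (prev_next cu).
    exact: next_cycle cc (cG x).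
  by rewrite (fconnect_cycle (cycle_next cu) (cG x)) cG.
apply/setP=> e; apply/imsetP/imsetP => -[x _ ->]; exists x => //.
Qed.

Lemma successor_hamiltonian_cycle f :
  2 < #|G| -> hamiltonian_successor f -> hamiltonian_cycle (successor_edges f).
Proof.
move=> G3 fH; have [finj fadj fC] := fH.
have /card_gt0P[x0 _] : 0 < #|G| by apply: leq_trans G3.
have x0G x : x \in fingraph.orbit f x0 by rewrite -fconnect_orbit fC.
have cyc : fcycle f (fingraph.orbit f x0) by apply: cycle_orbit.
exists (fingraph.orbit f x0); split => //.
- apply/andP; split; last exact: orbit_uniq.
  by apply: sub_cycle cyc => x y /eqP<-.
- by rewrite size_orbit order_successor.
apply/setP=> e; apply/imsetP/imsetP => -[x _ ->]; exists x => //;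
  by rewrite (eqP (next_cycle cyc (x0G x))).
Qed.

Lemma finv_hamiltonian_successor f :
  hamiltonian_successor f -> hamiltonian_successor (finv f).
Proof.
move=> [finj fadj fC]; split=> [|x|x y]; first exact: finv_inj.
  by rewrite adj_sym -{2}(f_finv finj x).
by rewrite (same_fconnect_finv finj).
Qed.

Lemma successor_edges_finv f :
  injective f -> successor_edges (finv f) = successor_edges f.
Proof.
move=> finj; apply/setP=> e; apply/imsetP/imsetP => -[x _ ->].
  by exists (finv f x); rewrite // f_finv // setUC.
by exists (f x); rewrite // finv_f // setUC.
Qed.

Lemma map_successor_edges s f g :
  (forall x, s (f x) = g (s x)) ->
  map_edges s (successor_edges f) = successor_edges g.
Proof.
move=> sfg; apply/setP=> e; apply/imsetP/imsetP.
  by case=> _ /imsetP[x _ ->] ->; exists (s x); rewrite // imsetU1 imset_set1 sfg.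
case=> x _ ->; exists [set (s^-1)%g x; f ((s^-1)%g x)]; first by apply: imset_f.
by rewrite imsetU1 imset_set1 sfg permKV.
Qed.

Lemma map_edgesM s s' (H : {set {set G}}) :
  map_edges (s * s')%g H = map_edges s' (map_edges s H).
Proof.
rewrite /map_edges -imset_comp; apply: eq_imset => e /=.
by rewrite -imset_comp; apply: eq_imset => x /=; rewrite permM.
Qed.

Lemma map_edgesK s : cancel (@map_edges G s) (map_edges s^-1%g).
Proof.
move=> H; rewrite -map_edgesM mulgV.
rewrite /map_edges -[RHS]imset_id; apply: eq_imset => e.
by rewrite -[RHS]imset_id; apply: eq_imset => x; rewrite perm1.
Qed.

Lemma automorphismV s : automorphism s -> automorphism (s^-1)%g.
Proof. by move=> sA x y; rewrite -sA !permKV. Qed.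

Lemma automorphismM s s' :
  automorphism s -> automorphism s' -> automorphism (s * s')%g.
Proof. by move=> sA s'A x y; rewrite !permM s'A sA. Qed.

Lemma hamiltonian_transitive_from (H0 : {set {set G}}) :
  hamiltonian_cycle H0 ->
  (forall H, hamiltonian_cycle H ->
     exists2 s, automorphism s & map_edges s H0 = H) ->
  hamiltonian_transitive G.
Proof.
move=> H0c H0s; split; first by exists H0.
move=> _ _ /H0s[s1 s1A <-] /H0s[s2 s2A <-].
exists (s1^-1 * s2)%g; first exact: automorphismM (automorphismV _) _.
by rewrite map_edgesM map_edgesK.
Qed.

End SuccessorFunctions.

Lemma isomorphic_card (G H : sgraph) : isomorphic G H -> #|G| = #|H|.
Proof. by case=> f /bij_eq_card. Qed.

(** * The cyclic successor on ordinals *)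

Section CyclicOrdinals.

Variable m : nat.

(** The modulus is at least 2; this is what makes joining edges lead to a different bead. *)
Lemma ordS_neq (i : 'I_m.+2) : ordS i != i.
Proof.
rewrite -val_eqE /=; have := ltn_ord i; rewrite leq_eqVlt => /orP[/eqP iE|im].
  by rewrite iE modnn; case: (val i) iE.
by rewrite modn_small // gtn_eqF.
Qed.

Lemma val_iter_ordS (i : 'I_m.+1) k : val (iter k (@ordS m.+1) i) = (i + k) %% m.+1.
Proof.
elim: k => [|k IHk] /=; first by rewrite addn0 modn_small.
by rewrite IHk -addn1 modnDml addn1 addnS.
Qed.

Lemma ordS_connected (i j : 'I_m.+1) : exists k, j = iter k (@ordS m.+1) i.
Proof.
(* Adding the complement of [i] stands for [j - i], which would truncate when [j < i]. *)
exists (j + (m.+1 - i)); apply: val_inj; rewrite val_iter_ordS addnCA.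
by rewrite subnKC ?(ltnW (ltn_ord i)) // modnDr modn_small.
Qed.

Lemma iter_ordS0 (j : 'I_m.+1) : iter j (@ordS m.+1) ord0 = j.
Proof. by apply: val_inj; rewrite val_iter_ordS add0n modn_small. Qed.

End CyclicOrdinals.

(** * The necklace graph and its regularity *)

Section Necklace.

Variables m d : nat.

(** Bead index and position in the bead; position [ord0] is the end [u] and [ord_max] is the end
    [v]. *)
Local Notation V := ('I_m.+2 * 'I_d.+1)%type.
Implicit Types (x y : V) (i j : 'I_m.+2) (a b : 'I_d.+1).

Definition end_pair a b :=
  (a == ord0) && (b == ord_max) || (a == ord_max) && (b == ord0).

Definition same_bead_adj x y :=
  [&& x.1 == y.1, x != y & ~~ end_pair x.2 y.2].

Definition link x y := [&& x.2 == ord_max, y.2 == ord0 & y.1 == ordS x.1].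

Definition necklace_adj x y := [|| same_bead_adj x y, link x y | link y x].

Lemma end_pairC a b : end_pair a b = end_pair b a.
Proof. by rewrite /end_pair orbC; congr (_ || _); rewrite andbC. Qed.

Lemma necklace_adj_sym : symmetric necklace_adj.
Proof.
move=> x y; rewrite /necklace_adj /same_bead_adj end_pairC [y.1 == _]eq_sym.
by rewrite [y == x]eq_sym [link y x || _]orbC.
Qed.

Lemma necklace_adj_irrefl : irreflexive necklace_adj.
Proof.
move=> x; rewrite /necklace_adj /same_bead_adj /link eqxx /= eqxx /= orbb.
by rewrite [x.1 == _]eq_sym (negbTE (ordS_neq _)) !andbF.
Qed.

Definition necklace := SGraph necklace_adj_sym necklace_adj_irrefl.

Lemma card_necklace : #|necklace| = m.+2 * d.+1.
Proof. by rewrite card_prod !card_ord. Qed.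

Hypothesis d_gt1 : 1 < d.

Lemma necklace_gt2 : 2 < #|necklace|.
Proof. by rewrite card_necklace mulSn (leq_trans _ (leq_addr _ _)). Qed.

Lemma ord_max_neq0 : (ord_max : 'I_d.+1) != ord0.
Proof. by rewrite -val_eqE /= -lt0n ltnW. Qed.

Lemma necklace_adj_link i : necklace_adj (i, ord_max) (ordS i, ord0).
Proof. by rewrite /necklace_adj /link /= !eqxx orbT. Qed.

(* The neighbours of [(i, a)] are parametrised by [b != a]: the vertex [(i, b)]
   is replaced by the far end of the joining edge when [ab] is the deleted
   edge of the bead. *)
Lemma necklace_regular : regular d necklace.
Proof.
case=> i a.
pose h b : V := if end_pair a b then
  if a == ord_max then (ordS i, ord0) else (ord_pred i, ord_max) else (i, b).
have i_pred : ord_pred i != i.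
  by have := ordS_neq (ord_pred i); rewrite ord_predK eq_sym.
have h_out b : end_pair a b -> (h b).1 != i.
  by rewrite /h => ->; case: ifP => _ //=; rewrite ordS_neq.
have hinj : {in [set~ a] &, injective h}.
  move=> b b' _ _ hbb'.
  case Eb: (end_pair a b); case Eb': (end_pair a b').
  - move: Eb Eb' {hbb'}; rewrite /end_pair.
    case: (a =P ord0) => [->|_] /=.
      by rewrite [ord0 == _]eq_sym (negbTE ord_max_neq0) /= !orbF => /eqP-> /eqP->.
    by move=> /andP[_ /eqP->] /andP[_ /eqP->].
  - by have := h_out _ Eb; rewrite hbb' /h Eb' eqxx.
  - by have := h_out _ Eb'; rewrite -hbb' /h Eb eqxx.
  - by move: hbb'; rewrite /h Eb Eb' => -[].
transitivity #|h @: [set~ a]|; last first.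
  by rewrite card_in_imset // cardsC1 card_ord.
apply: eq_card => -[j b]; rewrite inE /=; apply/idP/imsetP.
- rewrite /necklace_adj /same_bead_adj /link /= => /or3P[].
  + case/and3P=> /eqP<- ab Eab; exists b; last by rewrite /h (negbTE Eab).
    by rewrite !inE; apply: contraNneq ab => ->.
  + case/and3P=> /eqP aE /eqP-> /eqP->; exists ord0.
      by rewrite !inE aE eq_sym ord_max_neq0.
    by rewrite /h /end_pair aE !eqxx orbT.
  + case/and3P=> /eqP-> /eqP aE /eqP iE; exists ord_max.
      by rewrite !inE aE ord_max_neq0.
    by rewrite /h /end_pair aE iE !eqxx /= [ord0 == _]eq_sym (negbTE ord_max_neq0) ordSK.
- case=> b'; rewrite !inE => b'a; rewrite /h.
  case: ifPn => Eab'; last first.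
    case=> -> ->; rewrite /necklace_adj /same_bead_adj /= eqxx Eab' andbT.
    by rewrite xpair_eqE eqxx /= eq_sym b'a.
  case: (a =P ord_max) => [->|/eqP am] [-> ->]; first exact: necklace_adj_link.
  move: Eab'; rewrite /end_pair (negbTE am) orbF => /andP[/eqP-> _].
  by rewrite necklace_adj_sym -{2}(ord_predK i); apply: necklace_adj_link.
Qed.

(** * A reference Hamiltonian cycle, visiting each bead in increasing order of position *)

Definition standard_succ x : V :=
  if x.2 == ord_max then (ordS x.1, ord0) else (x.1, inord x.2.+1).

Lemma iter_standard_succ i a : iter a standard_succ (i, ord0) = (i, a).
Proof.
have H k : k < d.+1 -> iter k standard_succ (i, ord0) = (i, inord k).
  elim: k => [|k IHk] kd; first by congr (_, _); apply: val_inj; rewrite /= inordK.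
  rewrite iterS IHk ?(ltnW kd) // /standard_succ /= -val_eqE /= inordK ?(ltnW kd) //.
  by rewrite ltn_eqF.
by rewrite H // inord_val.
Qed.

Lemma standard_succ_last i : standard_succ (i, ord_max) = (ordS i, ord0).
Proof. by rewrite /standard_succ eqxx. Qed.

Lemma inord_ltS a : a != ord_max -> (inord a.+1 : 'I_d.+1) = a.+1 :> nat.
Proof.
by move=> am; rewrite inordK // ltnS ltn_neqAle -ltnS ltn_ord andbT.
Qed.

Lemma standard_succ_connected x y : fconnect standard_succ x y.
Proof.
have step i : fconnect standard_succ (i, ord0) (ordS i, ord0).
  rewrite -standard_succ_last -[X in standard_succ X]iter_standard_succ -iterS.
  exact: fconnect_iter.
have reach i j b : fconnect standard_succ (i, ord0) (j, b).
  have [k ->] := ordS_connected i j.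
  rewrite -[(_, b)]iter_standard_succ; apply: connect_trans (fconnect_iter _ _ _).
  by elim: k => [|k IHk] //=; apply: connect_trans IHk (step _).
(* From an arbitrary vertex, first finish its bead and cross to the start of the next one, from
   which everything is reached. *)
case: x y => i a [j b]; apply: (connect_trans (y := (ordS i, ord0))) (reach _ _ _).
rewrite -standard_succ_last; apply: connect_trans (fconnect1 _ _).
rewrite -[(i, ord_max)]iter_standard_succ -[(i, a)]iter_standard_succ.
have -> : val (ord_max : 'I_d.+1) = d - a + a by rewrite subnK // -ltnS.
by rewrite iterD; apply: fconnect_iter.
Qed.

Lemma standard_succ_hamiltonian : @hamiltonian_successor necklace standard_succ.
Proof.
split; last exact: standard_succ_connected.
- case=> i a [j b]; rewrite /standard_succ /=.
  case: (altP (a =P _)) => [->|am]; case: (altP (b =P _)) => [->|bm] E;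
    have /= ij := congr1 fst E; have /= /(congr1 val) := congr1 snd E.
  + by rewrite (ordS_inj ij).
  + by rewrite /= inord_ltS.
  + by rewrite /= inord_ltS.
  + by rewrite /= !inord_ltS // ij => -[/val_inj->].
- case=> i a; rewrite /standard_succ /=.
  case: (altP (a =P _)) => [->|am]; first exact: necklace_adj_link.
  rewrite /necklace_adj /same_bead_adj /= eqxx /= /end_pair (negbTE am) orbF.
  rewrite xpair_eqE eqxx /= -!val_eqE /= inord_ltS // neq_ltn ltnSn /=.
  (* Consecutive positions could form the deleted edge only as 0 and 1 with [d = 1]. *)
  apply/orP; left; apply/negP => /andP[/eqP-> /eqP dE].
  by move: d_gt1; rewrite -dE.
Qed.

(** * Automorphisms permuting the inner vertices of each bead *)

Section BeadAutomorphism.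

Variable s : {perm V}.
Hypothesis s_bead : forall x, (s x).1 = x.1.
Hypothesis s0 : forall i, s (i, ord0) = (i, ord0).
Hypothesis smax : forall i, s (i, ord_max) = (i, ord_max).

(** Adjacency depends only on the bead indices, on equality of vertices, and on which vertices are
    ends; [s] preserves all three. *)
Lemma bead_automorphism : @automorphism necklace s.
Proof.
have fixed a : (forall i, s (i, a) = (i, a)) ->
    forall x, ((s x).2 == a) = (x.2 == a).
  move=> sa x; apply/eqP/eqP => [E|xa].
    have -> // : x = (x.1, a).
    by apply: (@perm_inj _ s); rewrite sa -E -(s_bead x) -surjective_pairing.
  by rewrite [x]surjective_pairing xa sa.
have [f0 fm] := (fixed _ s0, fixed _ smax).
move=> x y; rewrite /= /necklace_adj /same_bead_adj /link /end_pair.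
by rewrite !f0 !fm !s_bead (inj_eq perm_inj).
Qed.

End BeadAutomorphism.

(** * Orienting a Hamiltonian cycle along the joining edges *)

Definition positively_oriented (f : V -> V) :=
  forall i, f (i, ord_max) = (ordS i, ord0).

Lemma necklace_adj_leave x y :
  necklace_adj x y -> y.1 != x.1 ->
  (exists i, x = (i, ord_max) /\ y = (ordS i, ord0)) \/
  (exists i, x = (ordS i, ord0) /\ y = (i, ord_max)).
Proof.
case: x y => i a [j b]; rewrite /necklace_adj /same_bead_adj /link /=.
case/or3P => /and3P[].
- by move/eqP->; rewrite eqxx.
- by move=> /eqP-> /eqP-> /eqP-> _; left; exists i.
- by move=> /eqP-> /eqP-> /eqP-> _; right; exists j.
Qed.

(** Otherwise the orbit of [(i, ord0)] would be trapped in bead [i] and miss the next bead. *)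
Lemma successor_leaves_bead f i :
  @hamiltonian_successor necklace f -> exists2 x, x.1 = i & (f x).1 != i.
Proof.
case=> _ _ fC; suff /existsP[x /andP[/eqP xi fxi]] :
  [exists x : V, (x.1 == i) && ((f x).1 != i)] by exists x.
apply: contraT => /existsPn stay.
have /iter_findex := fC (i, ord0) (ordS i, ord0).
suff : forall k, (iter k f (i, ord0)).1 = i.
  move=> H E; have := ordS_neq i.
  by rewrite -[X in _ != X](H (findex f (i, ord0) (ordS i, ord0))) E eqxx.
elim=> //= k IHk; have := stay (iter k f (i, ord0)).
by rewrite IHk eqxx /= negbK => /eqP.
Qed.

(** The next bead must be left too, and leaving it backwards would retrace the joining edge by which
    it was just entered, a 2-cycle. *)
Lemma successor_propagates f i :
  @hamiltonian_successor necklace f ->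
  f (i, ord_max) = (ordS i, ord0) ->
  f (ordS i, ord_max) = (ordS (ordS i), ord0).
Proof.
move=> fH fi; have [x xi fxi] := successor_leaves_bead (ordS i) fH.
have [_ fadj _] := fH.
have := necklace_adj_leave (fadj x); rewrite xi => /(_ fxi).
case=> -[j [xE fxE]]; rewrite xE /= in xi.
  by rewrite -xi -xE fxE.
move/ordS_inj: xi => ji; have := @successor_no_2cycle necklace f (i, ord_max) necklace_gt2 fH.
by rewrite fi -{1}ji -xE fxE ji eqxx.
Qed.

Lemma positively_oriented_from f i :
  @hamiltonian_successor necklace f -> f (i, ord_max) = (ordS i, ord0) ->
  positively_oriented f.
Proof.
move=> fH fi j; have [k ->] := ordS_connected i j.
by elim: k => //= k; apply: successor_propagates.
Qed.

Lemma hamiltonian_cycle_oriented (H : {set {set necklace}}) :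
  hamiltonian_cycle H ->
  exists f, [/\ @hamiltonian_successor necklace f, positively_oriented f
              & H = successor_edges f].
Proof.
case/hamiltonian_cycle_successor => f fH HE; have [finj fadj _] := fH.
have [x xi fxi] := successor_leaves_bead ord0 fH.
rewrite -xi in fxi; case: (necklace_adj_leave (fadj x) fxi) => -[j [xE fxE]].
  by exists f; split=> //; apply: (positively_oriented_from (i := j)) => //; rewrite -xE.
(* Bead [ord0] is left backwards here, so the reversed cycle, which has the same edges, is used. *)
have f'H := finv_hamiltonian_successor fH.
exists (finv f); split => //; last by rewrite successor_edges_finv.
by apply: (positively_oriented_from (i := j)) => //; rewrite -fxE finv_f.
Qed.

(** * A positively oriented cycle exhausts each bead before leaving it *)

Section BeadTraversal.

Variable f : V -> V.
Hypothesis fH : @hamiltonian_successor necklace f.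
Hypothesis f_pos : positively_oriented f.

Lemma iter_successor_inj x k l :
  k < #|necklace| -> l < #|necklace| -> iter k f x = iter l f x -> k = l.
Proof.
rewrite -(@order_successor necklace f x fH) => kG lG E.
by rewrite -(findex_iter kG) E findex_iter.
Qed.

(** The only other exit is a joining edge taken backwards, but [f_pos] already uses it forwards. *)
Lemma successor_stays x : x.2 != ord_max -> (f x).1 = x.1.
Proof.
move=> xm; have [_ fadj _] := fH; apply/eqP; apply: contraNT xm => fx.
case: (necklace_adj_leave (fadj x) fx) => -[j [xE fxE]]; first by rewrite xE.
have := @successor_no_2cycle necklace f x necklace_gt2 fH.
by rewrite fxE f_pos xE eqxx.
Qed.

Definition crossing_time i := findex f (i, ord0) (i, ord_max).

Lemma iter_crossing_time i : iter (crossing_time i) f (i, ord0) = (i, ord_max).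
Proof. by case: fH => _ _ fC; apply: iter_findex; apply: fC. Qed.

(** [findex] is the first hitting time, so [ord_max] is not met earlier and [successor_stays]
    applies at each step. *)
Lemma iter_before_crossing i k :
  k <= crossing_time i -> (iter k f (i, ord0)).1 = i.
Proof.
elim: k => //= k IHk kt; have ki := IHk (ltnW kt).
rewrite successor_stays //; apply/eqP => km.
have kE : iter k f (i, ord0) = (i, ord_max).
  by rewrite [LHS]surjective_pairing ki km.
have [_ _ fC] := fH; have := ltn_trans kt (findex_max (fC (i, ord0) (i, ord_max))).
by move/findex_iter; rewrite kE => tk; rewrite /crossing_time tk ltnn in kt.
Qed.

(** The iterates from time 0 to the crossing time are distinct vertices of one bead, which has
    [d.+1] vertices. *)
Lemma crossing_time_le i : crossing_time i <= d.
Proof.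
have tG : crossing_time i < #|necklace|.
  by case: fH => _ _ fC; rewrite -(@order_successor necklace f (i, ord0) fH) findex_max.
pose h (k : 'I_(crossing_time i).+1) := (iter k f (i, ord0)).2.
have /leq_card : injective h.
  move=> k l hkl; apply: val_inj.
  have kG (k' : 'I_(crossing_time i).+1) : k' < #|necklace|.
    by apply: leq_ltn_trans tG; rewrite -ltnS.
  apply: (iter_successor_inj (x := (i, ord0)) (kG k) (kG l)).
  rewrite [LHS]surjective_pairing [RHS]surjective_pairing.
  by rewrite !iter_before_crossing -1?ltnS //; congr (_, _).
by rewrite !card_ord.
Qed.

(** Each bead costs its crossing time plus one step for the joining edge. *)
Lemma iter_around k :
  iter (\sum_(j < k) (crossing_time (iter j (@ordS m.+2) ord0)).+1) f (ord0, ord0)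
  = (iter k (@ordS m.+2) ord0, ord0).
Proof.
elim: k => [|k IHk]; first by rewrite big_ord0.
by rewrite big_ord_recr /= addnC iterD IHk iterS iter_crossing_time f_pos.
Qed.

(* Going once around takes at least as many steps as there are vertices, while
   no bead takes more than [d + 1] steps. *)
Lemma crossing_timeE i : crossing_time i = d.
Proof.
have le_t j : true -> (crossing_time j).+1 <= d.+1 ?= iff (crossing_time j == d).
  by move=> _; split; [rewrite ltnS crossing_time_le | rewrite eqSS].
have /= := leqif_sum le_t; rewrite sum_nat_const card_ord => -[le_sum eq_sum].
suff : m.+2 * d.+1 <= \sum_j (crossing_time j).+1.
  move=> ge_sum; move: eq_sum; rewrite eqn_leq le_sum ge_sum => /esym/forallP.
  by move=> /(_ i) /eqP.
rewrite -card_necklace; apply: (@return_time_ge necklace f (ord0, ord0) _ fH).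
  by rewrite big_ord_recl.
rewrite (eq_bigr (fun j : 'I_m.+2 =>
  (crossing_time (iter j (@ordS m.+2) ord0)).+1)) => [|j _].
  rewrite iter_around; congr (_, _); apply: val_inj.
  by rewrite val_iter_ordS add0n modnn.
by rewrite iter_ordS0.
Qed.

(** The future automorphism: it sends position [a] of a bead to the vertex that [f] visits [a] steps
    after entering it, and so conjugates [standard_succ] to [f]. *)
Definition bead_traversal x := iter x.2 f (x.1, ord0).

Lemma bead_traversal_bead x : (bead_traversal x).1 = x.1.
Proof. by rewrite iter_before_crossing // crossing_timeE -ltnS. Qed.

(** Beads are preserved, and within one bead fewer than [#|necklace|] steps are taken, so the
    iterates differ. *)
Lemma bead_traversal_inj : injective bead_traversal.
Proof.
case=> i a [j b] E.
have ij : i = j by have := congr1 fst E; rewrite !bead_traversal_bead.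
rewrite -{j}ij in E *; congr (_, _); apply: val_inj.
have aG (c : 'I_d.+1) : c < #|necklace|.
  by rewrite card_necklace mulSn (leq_trans (ltn_ord c)) ?leq_addr.
exact: iter_successor_inj (aG a) (aG b) E.
Qed.

Lemma bead_traversal_last i : bead_traversal (i, ord_max) = (i, ord_max).
Proof. by have := iter_crossing_time i; rewrite crossing_timeE. Qed.

Lemma bead_traversal_succ x : bead_traversal (standard_succ x) = f (bead_traversal x).
Proof.
case: x => i a; rewrite {1}/standard_succ /=.
case: (altP (a =P _)) => [->|am]; first by rewrite bead_traversal_last f_pos.
by rewrite /bead_traversal /= inord_ltS.
Qed.

End BeadTraversal.

(** * Hamiltonian-transitivity and the infinite family *)

Lemma necklace_hamiltonian_transitive : hamiltonian_transitive necklace.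
Proof.
apply: (hamiltonian_transitive_from (H0 := @successor_edges necklace standard_succ)).
  exact: successor_hamiltonian_cycle necklace_gt2 standard_succ_hamiltonian.
move=> H /hamiltonian_cycle_oriented[f [fH f_pos ->]].
have sE := permE (bead_traversal_inj fH f_pos).
exists (perm (bead_traversal_inj fH f_pos)).
  apply: bead_automorphism => [x|i|i]; rewrite sE //.
    exact: bead_traversal_bead.
  exact: bead_traversal_last.
apply: (map_successor_edges (G := necklace)) => x.
by rewrite !sE bead_traversal_succ.
Qed.

End Necklace.

Theorem mainTheorem5 (d : nat) (hd : 2 <= d) :
  exists G : nat -> sgraph,
    (forall i j : nat, i <> j -> ~ isomorphic (G i) (G j)) /\
    (forall i : nat, regular d (G i) /\ hamiltonian_transitive (G i)).
Proof.
(* For fixed [d], the number of vertices determines the number of beads [m.+2]. *)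
exists (fun m => necklace m d); split=> [i j nij /isomorphic_card|m].
  by rewrite !card_necklace => /eqP; rewrite eqn_pmul2r // !eqSS => /eqP.
by split; [exact: necklace_regular | exact: necklace_hamiltonian_transitive].
Qed.
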